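(* Let $N\ge1$ and let $p,x_1,\dots,x_N$ be nonzero real numbers. Let $d_k(p)=d_k(p,x_1,\dots,x_N)$ be the coefficients of the polynomial $P(t)=t(1-t)\prod_{i=1}^N(1-x_it)$ expanded in powers of $u=1-pt$, i.e. $P(t)=\sum_{k=0}^{N+2}d_k(p)u^k$. Then for $k=0,\dots,N+2$, $$d_k(p)=\frac{x_1\cdots x_N}{p^{N+2}}\left[\sigma_{N+1-k}\Bigl(p-1,\bigl(\tfrac{p-x_j}{x_j}\bigr)_{j=1,\dots,N}\Bigr)-\sigma_{N+2-k}\Bigl(p-1,\bigl(\tfrac{p-x_j}{x_j}\bigr)_{j=1,\dots,N}\Bigr)\right].$$
   Context: $\sigma_l(y_1,\dots,y_k)$ is the $l$-th elementary symmetric polynomial in $k$ variables, with $\sigma_0=1$ (also for $k=0$) and $\sigma_l=0$ if $l<0$ or $l>k$. *)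

(* Defs.v *)
From mathcomp Require Import all_boot all_order all_algebra.
From mathcomp Require Import reals.
From mathcomp Require mpoly.

Set Implicit Arguments.
Unset Strict Implicit.
Unset Printing Implicit Defensive.

Import GRing.Theory Num.Theory.
Local Open Scope ring_scope.

(* The index is an [int]: truncated subtraction on [nat] would turn a negative
   index into 0, hence sigma into 1 instead of 0.  For l > n, [mesym] is an
   empty sum. *)
Definition sigma (R : realType) (n : nat) (l : int) (y : n.-tuple R) : R :=
  if l is Posz m then mpoly.meval (tnth y) (mpoly.mesym n R m) else 0.

Definition Ppoly (R : realType) (N : nat) (x : 'I_N -> R) : {poly R} :=
  'X * (1 - 'X) * \prod_(i < N) (1 - x i *: 'X).

(* Determines d uniquely when p != 0, since 1 - p t then has degree 1. *)
Definition is_expansion (R : realType) (N : nat) (p : R) (x : 'I_N -> R)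
    (d : 'I_N.+3 -> R) : Prop :=
  Ppoly x = \sum_(k < N.+3) d k *: (1 - p *: 'X) ^+ k.

Definition shifted_args (R : realType) (N : nat) (p : R) (x : 'I_N -> R) :
    N.+1.-tuple R :=
  [tuple of p - 1 :: [tuple (p - x j) / x j | j < N]].

Lemma sigma0 (R : realType) (n : nat) (y : n.-tuple R) : sigma 0 y = 1.
Proof. by rewrite /sigma /= mpoly.mesym0E mpoly.meval1. Qed.

Lemma sigma_lt0 (R : realType) (n : nat) (l : int) (y : n.-tuple R) :
  l < 0 -> sigma l y = 0.
Proof. by case: l. Qed.

Lemma sigma_gt (R : realType) (n : nat) (l : int) (y : n.-tuple R) :
  n%:Z < l -> sigma l y = 0.
Proof.
case: l => // m; rewrite ltz_nat => nm.
rewrite /sigma mpoly.mesymE big_pred0 ?mpoly.meval0 // => h.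
by apply/negbTE; rewrite neq_ltn (leq_ltn_trans (max_card _)) // card_ord.
Qed.

Lemma size_Ppoly (R : realType) (N : nat) (x : 'I_N -> R) :
  (size (Ppoly x) <= N.+3)%N.
Proof.
have s1 (a : R) : (size (1 - a *: 'X : {poly R})%R <= 2)%N.
  rewrite (leq_trans (size_polyD _ _)) // geq_max size_poly1 size_polyN /=.
  by rewrite (leq_trans (size_scale_leq _ _)) // size_polyX.
have sM (q r : {poly R}) m :
    (size q <= 2 -> size r <= m.+1 -> size (q * r)%R <= m.+2)%N.
  move=> sq sr; apply: leq_trans (size_polyMleq _ _) _.
  by rewrite -subn1 leq_subLR; apply: leq_trans (leq_add sq sr) _.
rewrite /Ppoly -mulrA; apply: (sM); first by rewrite size_polyX.
apply: (sM); first by have := s1 1; rewrite scale1r.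
elim: N x => [|N IH] x; first by rewrite big_ord0 size_poly1.
by rewrite big_ord_recl; apply: (sM).
Qed.

Lemma is_expansion_exists (R : realType) (N : nat) (p : R) (x : 'I_N -> R) :
  p != 0 -> exists d : 'I_N.+3 -> R, is_expansion p x d.
Proof.
move=> p0; pose r : {poly R} := p^-1 *: (1 - 'X).
pose u : {poly R} := 1 - p *: 'X.
have ru : r \Po u = 'X.
  rewrite /r /u comp_polyZ comp_polyB comp_polyX -[1 in X in X - _]/(1%:P) comp_polyC.
  by rewrite opprB addrCA subrr addr0 scalerA mulVf // scale1r.
have sr : (size r <= 2)%N.
  apply: leq_trans (size_scale_leq _ _) _.
  by rewrite (leq_trans (size_polyD _ _)) // geq_max size_poly1 size_polyN size_polyX.
have sPr : (size (Ppoly x \Po r) <= N.+3)%N.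
  apply: leq_trans (size_comp_poly_leq _ _) _; rewrite ltnS -[N.+2]muln1.
  by apply: leq_mul; rewrite -subn1 leq_subLR // add1n size_Ppoly.
exists (fun k => (Ppoly x \Po r)`_k).
rewrite /is_expansion -/u -[LHS]comp_polyXr -ru comp_polyA.
rewrite comp_polyE (big_ord_widen N.+3 (fun i => (Ppoly x \Po r)`_i *: u ^+ i)) //.
rewrite big_mkcond; apply: eq_bigr => i _; case: ltnP => // si.
by rewrite nth_default ?scale0r.
Qed.

(* Main.v *)
Require Import Defs.
From mathcomp Require Import all_boot all_order all_algebra.
From mathcomp Require Import reals.
From mathcomp Require mpoly.
From mathcomp Require Import ring zify.

Set Implicit Arguments.
Unset Strict Implicit.
Unset Printing Implicit Defensive.

Import GRing.Theory Num.Theory.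
Local Open Scope ring_scope.

(** The expansion in powers of u = 1 - p t becomes the ordinary coefficient
    sequence after the substitution t = (1 - u) / p, which inverts t |-> u.
    Under it every factor of P becomes affine in u, up to a constant:
    t = (1 - u) / p, 1 - t = (u + (p - 1)) / p, and
    1 - x_i t = (x_i / p) (u + (p - x_i) / x_i).
    Hence P is the constant x_1 ... x_N / p ^ (N + 2) times (1 - u) Q(u), where
    Q is the product of the u + y over the N + 1 shifted arguments y
    ([Ppoly_comp_affine]).  By Viete's formulas the coefficient of u ^ k in Q is
    sigma_(N+1-k) ([coef_prod_XaddC]), and multiplying by 1 - u subtracts from
    it the preceding coefficient sigma_(N+2-k). *)

Lemma meval_mesym (R : comNzRingType) (n m : nat) (v : 'I_n -> R) :
  mpoly.meval v (mpoly.mesym n R m) =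
  \sum_(h : {set 'I_n} | #|h| == m) \prod_(i in h) v i.
Proof.
rewrite /mpoly.mesym (big_morph _ (mpoly.mevalD v) (mpoly.meval0 v)).
apply: eq_bigr => h _.
rewrite (big_morph _ (mpoly.mevalM v) (mpoly.meval1 v)).
by apply: eq_bigr => i _; rewrite mpoly.mevalXU.
Qed.

(** Viete's formulas for the polynomial with roots - y: the m-th elementary
    symmetric polynomial is homogeneous of degree m, so the signs of the roots
    cancel the alternating sign.  Beyond the degree, k > n, the coefficient is 0
    and the index n - k is negative, so both sides vanish. *)
Lemma coef_prod_XaddC (R : realType) (n : nat) (y : n.-tuple R) (k : nat) :
  (\prod_(a <- y) ('X + a%:P))`_k = sigma (n%:Z - k%:Z) y.
Proof.
pose ny := [tuple of map -%R y].
have -> : \prod_(a <- y) ('X + a%:P) = \prod_(c <- ny) ('X - c%:P).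
  by rewrite big_map; apply: eq_bigr => a _; rewrite polyCN opprK.
have [nk | kn] := ltnP n k.
  by rewrite sigma_lt0 ?subr_lt0 // nth_default // size_prod_XsubC size_tuple.
have lt_nk : (n - k < n.+1)%N by rewrite ltnS leq_subr.
rewrite subzn // -{1}(subKn kn).
rewrite (mpoly.mroots_coeff ny (Ordinal lt_nk)) /= !meval_mesym mulr_sumr.
apply: eq_bigr => h /eqP <-.
rewrite [X in _ * X](eq_bigr (fun i => - tnth y i)); last first.
  by move=> i _; rewrite tnth_map.
by rewrite prodrN mulrA -exprD addnn -mul2n exprM sqrrN !expr1n mul1r.
Qed.

Lemma comp_affine_oneB (R : realType) (p a : R) : p != 0 -> a != 0 ->
  (1 - a *: 'X) \Po (p^-1 *: (1 - 'X)) =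
  (a / p) *: ('X + ((p - a) / a)%:P).
Proof.
move=> p0 a0.
rewrite comp_polyB comp_polyZ comp_polyX -[1 in X in X - _]/(1%:P) comp_polyC.
rewrite -!mul_polyC; have -> : 1%:P = (a / p)%:P * ((p - a) / a)%:P + (a / p)%:P.
  by rewrite -polyCM -polyCD; congr _%:P; field; rewrite p0 a0.
by rewrite mulrA -polyCM; ring.
Qed.

Lemma Ppoly_comp_affine (R : realType) (N : nat) (p : R) (x : 'I_N -> R) :
  p != 0 -> (forall i, x i != 0) ->
  Ppoly x \Po (p^-1 *: (1 - 'X)) =
  ((\prod_(i < N) x i) / p ^+ (N + 2)) *:
    ((1 - 'X) * \prod_(a <- shifted_args p x) ('X + a%:P)).
Proof.
move=> p0 x0; have := comp_affine_oneB p0 (oner_neq0 R).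
rewrite scale1r divr1 mul1r => oneB_comp.
rewrite /Ppoly !comp_polyM comp_polyX oneB_comp (rmorph_prod (comp_poly _)) /=.
rewrite (eq_bigr _ (fun i _ => comp_affine_oneB p0 (x0 i))) scaler_prod.
rewrite big_split /= prodr_const card_ord.
rewrite big_cons big_map big_enum /=.
rewrite -!mul_polyC addn2 !exprS invfM invfM exprVn !polyCM; ring.
Qed.

(** Composition with the inverse of t |-> 1 - p t turns each (1 - p t) ^ i into
    the monomial 'X^i. *)
Lemma is_expansion_coef (R : realType) (N : nat) (p : R) (x : 'I_N -> R)
    (d : 'I_N.+3 -> R) (k : 'I_N.+3) :
  p != 0 -> is_expansion p x d ->
  d k = (Ppoly x \Po (p^-1 *: (1 - 'X)))`_k.
Proof.
move=> p0 ->; have compu : (1 - p *: 'X) \Po (p^-1 *: (1 - 'X)) = 'X :> {poly R}.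
  by rewrite comp_affine_oneB // divff // subrr mul0r addr0 scale1r.
rewrite raddf_sum coef_sum (bigD1 k) //= big1 => [|i ik].
  by rewrite comp_polyZ rmorphXn /= compu coefZ coefXn eqxx mulr1 addr0.
rewrite comp_polyZ rmorphXn /= compu coefZ coefXn.
by rewrite eq_sym (inj_eq val_inj) (negPf ik) mulr0.
Qed.

Theorem lemma4p4 (R : realType) (N : nat) (p : R) (x : 'I_N -> R)
    (d : 'I_N.+3 -> R) :
  (1 <= N)%N ->
  p != 0 ->
  (forall i, x i != 0) ->
  is_expansion p x d ->
  forall k : 'I_N.+3,
    d k = (\prod_(i < N) x i) / p ^+ (N + 2) *
          (sigma ((N + 1)%N%:Z - (k : nat)%:Z) (shifted_args p x)
           - sigma ((N + 2)%N%:Z - (k : nat)%:Z) (shifted_args p x)).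
Proof.
move=> _ p0 x0 dP k.
rewrite (is_expansion_coef k p0 dP) Ppoly_comp_affine // coefZ mulrBl mul1r.
rewrite coefB coefXM !coef_prod_XaddC addn1 addn2; congr (_ * (_ - _)).
case: (nat_of_ord k) => [|m]; rewrite ?eqxx.
  (* Only N + 1 variables, so sigma_(N+2) vanishes. *)
  by rewrite [RHS]sigma_gt // subr0 ltz_nat.
by congr (sigma _ _); lia.
Qed.
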